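(* Let $k$ be a positive integer and let $C$ be the two-dimensional flat cone whose angle at the vertex is equal to $2\pi/k$, endowed with its intrinsic metric. Then the Steiner ratio of $C$ is equal to the Steiner ratio of the Euclidean plane: $\operatorname{sr}(C)=\operatorname{sr}(\mathbb{R}^2)$.
   Context: Steiner ratio. Let $(X,\rho)$ be a metric space. For a finite subset $M\subset X$, $\operatorname{mst}_X(M)$ is the length of a minimal spanning tree: the minimum, over all trees with vertex set $M$, of the sum of $\rho(x,y)$ over the edges $xy$ of the tree. Put $\operatorname{smt}_X(M)=\inf\{\operatorname{mst}_X(N): M\subset N\subset X,\ N \text{ finite}\}$. For finite $M$ with at least two elements put $\operatorname{sr}_X(M)=\operatorname{smt}_X(M)/\operatorname{mst}_X(M)$. The Steiner ratio of $X$ is $\operatorname{sr}(X)=\inf_M \operatorname{sr}_X(M)$ over all finite $M\subset X$ with at least two elements. The two-dimensional (flat) cone with angle $\theta>0$ at the vertex is the space obtained from $[0,\infty)\times(\mathbb{R}/\theta\mathbb{Z})$ by collapsing $\{0\}\times(\mathbb{R}/\theta\mathbb{Z})$ to a point (the vertex), with the intrinsic metric $$d\bigl((r,a),(s,b)\bigr)=\sqrt{r^2+s^2-2rs\cos\bigl(\min\{|a-b|_\theta,\pi\}\bigr)},$$ where $|a-b|_\theta$ is the distance from $a$ to $b$ in the circle $\mathbb{R}/\theta\mathbb{Z}$ of length $\theta$. For $\theta=2\pi/k$ it is the quotient of the Euclidean plane by the group of rotations about the origin by multiples of $2\pi/k$. $\mathbb{R}^2$ carries the Euclidean metric. *)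

(* Defs.v *)
From HB Require Import structures.
From mathcomp Require Import all_boot all_order all_algebra finmap.
From mathcomp Require Import generic_quotient.
From mathcomp Require Import all_classical all_reals all_analysis.
From mathcomp Require Import ring lra.

Set Implicit Arguments.
Unset Strict Implicit.
Unset Printing Implicit Defensive.

Import Order.TTheory GRing.Theory Num.Theory.

Local Open Scope classical_set_scope.
Local Open Scope ring_scope.
Local Open Scope quotient_scope.

Definition is_tree (T : finType) (e : rel T) : Prop :=
  [/\ symmetric e, irreflexive e, (forall x y, connect e x y)
    & forall c : seq T, ucycle e c -> (size c <= 2)%N].

Section SteinerRatio.
Context {R : realType} (X : metricType R).
Implicit Types M N : {fset X}.

(* The sum runs over ordered pairs, so every edge is counted twice. *)
Definition tree_length M (e : rel M) : R :=
  (\sum_(x : M) \sum_(y : M | e x y) mdist (val x) (val y)) / 2.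

(* There are finitely many trees on M, and at least one if M is nonempty, so
   this infimum is a minimum. *)
Definition mst M : R :=
  inf [set l | exists2 e : rel M, is_tree e & l = tree_length e].

Definition smt M : R := inf [set mst N | N in [set N | (M `<=` N)%fset]].

Definition steiner_ratio_of M : R := smt M / mst M.

Definition steiner_ratio : R :=
  inf [set steiner_ratio_of M | M in [set M | (2 <= #|` M|)%N]].

End SteinerRatio.

Section PlaneNorm.
Context {R : realType}.
Implicit Types a b c d : R.

Lemma plane_norm_triangle a b c d :
  Num.sqrt ((a + c) ^+ 2 + (b + d) ^+ 2) <=
  Num.sqrt (a ^+ 2 + b ^+ 2) + Num.sqrt (c ^+ 2 + d ^+ 2).
Proof.
have P u v : 0 <= u ^+ 2 + v ^+ 2 :> R by rewrite addr_ge0 ?sqr_ge0.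
set n1 := Num.sqrt (a ^+ 2 + b ^+ 2); set n2 := Num.sqrt (c ^+ 2 + d ^+ 2).
have n1E : n1 ^+ 2 = a ^+ 2 + b ^+ 2 by rewrite sqr_sqrtr.
have n2E : n2 ^+ 2 = c ^+ 2 + d ^+ 2 by rewrite sqr_sqrtr.
have n1p : 0 <= n1 by exact: sqrtr_ge0.
have n2p : 0 <= n2 by exact: sqrtr_ge0.
have CS : a * c + b * d <= n1 * n2.
  have [neg|pos] := ltP (a * c + b * d) 0.
    by apply: (le_trans (ltW neg)); exact: mulr_ge0.
  rewrite -(ler_pXn2r (ltn0Sn 1)) ?nnegrE ?mulr_ge0// exprMn n1E n2E.
  rewrite -subr_ge0 (_ : _ - _ = (a * d - b * c) ^+ 2) ?sqr_ge0//; ring.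
rewrite -(ler_pXn2r (ltn0Sn 1)) ?nnegrE ?sqrtr_ge0 ?addr_ge0//.
rewrite sqr_sqrtr// [X in _ <= X]sqrrD n1E n2E -subr_ge0.
rewrite (_ : _ - _ = 2 * (n1 * n2 - (a * c + b * d))); last by rewrite mulr2n; ring.
by rewrite mulr_ge0// subr_ge0.
Qed.

Lemma plane_norm_eq0 a b : Num.sqrt (a ^+ 2 + b ^+ 2) = 0 -> a = 0 /\ b = 0.
Proof.
move=> /eqP; rewrite sqrtr_eq0 => h.
have /eqP : a ^+ 2 + b ^+ 2 = 0.
  by apply/eqP; rewrite eq_le h addr_ge0 ?sqr_ge0.
by rewrite paddr_eq0 ?sqr_ge0// !sqrf_eq0 => /andP[/eqP -> /eqP ->].
Qed.

End PlaneNorm.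

(* A separate name for R * R, whose own metric structure in the library is the
   one of the maximum norm. *)
Definition plane (R : realType) : Type := (R * R)%type.

HB.instance Definition _ (R : realType) := Choice.copy (plane R) (R * R)%type.

Section PlaneMetric.
Context {R : realType}.
Implicit Types p q r : plane R.

Definition plane_dist p q : R :=
  Num.sqrt ((p.1 - q.1) ^+ 2 + (p.2 - q.2) ^+ 2).

Lemma plane_distxx p : plane_dist p p = 0.
Proof. by rewrite /plane_dist !subrr expr0n addr0 sqrtr0. Qed.

Lemma plane_dist_positivity p q : plane_dist p q = 0 -> p = q.
Proof.
case: p q => [a b] [c d] /plane_norm_eq0/= [/eqP + /eqP].
by rewrite !subr_eq0 => /eqP -> /eqP ->.
Qed.

Lemma plane_dist_sym p q : plane_dist p q = plane_dist q p.
Proof.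
by rewrite /plane_dist -(opprB q.1) -(opprB q.2) !sqrrN.
Qed.

Lemma plane_dist_triangle q p r :
  plane_dist p r <= plane_dist p q + plane_dist q r.
Proof.
have := plane_norm_triangle (p.1 - q.1) (p.2 - q.2) (q.1 - r.1) (q.2 - r.2).
by rewrite !addrA !subrK.
Qed.

HB.instance Definition _ := isMetric.Build R (plane R)
  plane_distxx plane_dist_positivity plane_dist_sym plane_dist_triangle.

End PlaneMetric.

Section LawOfCosines.
Context {R : realType}.
Implicit Types r s t a b : R.

Definition law_of_cosines r s a : R :=
  Num.sqrt (r ^+ 2 + s ^+ 2 - 2 * r * s * cos a).

Lemma law_of_cosinesE r s a b :
  law_of_cosines r s (a - b) =
  Num.sqrt ((r * cos a - s * cos b) ^+ 2 + (r * sin a - s * sin b) ^+ 2).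
Proof.
congr (Num.sqrt _); rewrite cosB.
have ha := cos2Dsin2 a; have hb := cos2Dsin2 b.
rewrite -{1}[r ^+ 2]mulr1 -{1}[s ^+ 2]mulr1 -{1}ha -{1}hb; ring.
Qed.

Lemma law_of_cosines_triangle r s t a b :
  law_of_cosines r t (a + b) <= law_of_cosines r s a + law_of_cosines s t b.
Proof.
rewrite -{1}[b]opprK -[a in X in _ <= X]subr0 -[b in X in _ <= X]opprK.
rewrite -[- - b in X in _ <= X]add0r !law_of_cosinesE.
have := plane_norm_triangle (r * cos a - s * cos 0) (r * sin a - s * sin 0)
  (s * cos 0 - t * cos (- b)) (s * sin 0 - t * sin (- b)).
by rewrite !addrA !subrK.
Qed.

Lemma ler_law_of_cosines r s a b : 0 <= r -> 0 <= s ->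
  0 <= a -> a <= b -> b <= pi -> law_of_cosines r s a <= law_of_cosines r s b.
Proof.
move=> r0 s0 a0 ab bpi; apply: ler_wsqrtr; rewrite lerD2l lerN2.
apply: ler_wpM2l; first by rewrite !mulr_ge0.
rewrite leNgt ltr_cos ?in_itv/= -?leNgt ?a0 ?bpi ?(le_trans ab)//.
by rewrite (le_trans a0).
Qed.

Lemma law_of_cosines_pi r s : 0 <= r -> 0 <= s -> law_of_cosines r s pi = r + s.
Proof.
move=> r0 s0; rewrite /law_of_cosines cospi.
rewrite (_ : _ - _ = (r + s) ^+ 2); last by ring.
by rewrite sqrtr_sqr ger0_norm// addr_ge0.
Qed.

Lemma law_of_cosines_sym r s a : law_of_cosines r s a = law_of_cosines s r a.
Proof. by congr (Num.sqrt _); ring. Qed.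

Lemma law_of_cosinesxx r : law_of_cosines r r 0 = 0.
Proof.
rewrite /law_of_cosines cos0 (_ : _ - _ = 0) ?sqrtr0//; ring.
Qed.

Lemma law_of_cosines_eq0 r s a : 0 <= r -> 0 <= s -> 0 <= a -> a <= pi ->
  law_of_cosines r s a = 0 -> r = s /\ (r = 0 \/ a = 0).
Proof.
move=> r0 s0 a0 api /eqP; rewrite sqrtr_eq0.
rewrite (_ : _ - _ = (r - s) ^+ 2 + 2 * (r * s) * (1 - cos a)); last by ring.
have rs0 : 0 <= 2 * (r * s) * (1 - cos a).
  by rewrite !mulr_ge0// subr_ge0 cos_le1.
move=> h; have /eqP : (r - s) ^+ 2 + 2 * (r * s) * (1 - cos a) = 0.
  by apply/eqP; rewrite eq_le h addr_ge0 ?sqr_ge0.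
rewrite paddr_eq0 ?sqr_ge0// sqrf_eq0 subr_eq0 => /andP[/eqP rs].
rewrite -{}rs !mulf_eq0 pnatr_eq0/= => h'; split=> //; move: h'.
rewrite orbb => /orP[/eqP ->|]; first by left.
rewrite subr_eq0 -cos0 => /eqP/esym ca; right; apply: cos_inj => //.
  by rewrite in_itv/= a0.
by rewrite in_itv/= lexx pi_ge0.
Qed.

End LawOfCosines.

Section CircleDistance.
Context {R : realType} (theta : {posnum R}).
Local Notation th := (theta%:num).
Implicit Types a b c : R.

(* The distance between the classes of a and b in R / theta Z; the infimum is
   attained, see circle_dist_attained. *)
Definition circle_dist a b : R := inf [set `|a - b + n%:~R * th| | n in [set: int]].

Let lbd a b : lbound [set `|a - b + n%:~R * th| | n in [set: int]] 0.
Proof. by move=> _ [n _ <-]. Qed.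

Lemma circle_dist_le a b (n : int) : circle_dist a b <= `|a - b + n%:~R * th|.
Proof. by apply: ge_inf; [exists 0; exact: lbd|exists n]. Qed.

Lemma circle_dist_attained a b :
  exists n : int, circle_dist a b = `|a - b + n%:~R * th|.
Proof.
have th0 : 0 < th by [].
pose m := Num.floor ((a - b) / th).
have m1 : m%:~R * th <= a - b by rewrite -ler_pdivlMr// Num.Theory.ge_floor.
have m2 : a - b < (m + 1)%:~R * th.
  by rewrite -ltr_pdivrMr// Num.Theory.floorD1_gt.
suff [n hn] : exists n : int, forall l : int,
    `|a - b + n%:~R * th| <= `|a - b + l%:~R * th|.
  exists n; apply/eqP; rewrite eq_le circle_dist_le/=.
  apply: lb_le_inf; first by exists `|a - b + n%:~R * th|, n.
  by move=> _ [l _ <-].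
have key (l : int) : Num.min `|a - b + (- m)%:~R * th|
    `|a - b + (- (m + 1))%:~R * th| <= `|a - b + l%:~R * th|.
  rewrite ge_min; have [lm|lm] := lerP (- m) l; apply/orP; [left|right].
    rewrite ger0_norm; last by rewrite mulrNz mulNr subr_ge0.
    by apply: le_trans (ler_norm _); rewrite lerD2l ler_pM2r// ler_int.
  rewrite ltr0_norm; last by rewrite mulrNz mulNr subr_lt0.
  rewrite -[X in _ <= X]normrN; apply: le_trans (ler_norm _).
  by rewrite lerN2 lerD2l ler_pM2r// ler_int -ltzD1 opprD subrK.
have [h|h] := lerP `|a - b + (- m)%:~R * th| `|a - b + (- (m + 1))%:~R * th|.
  by exists (- m) => l; have := key l; rewrite min_l.
by exists (- (m + 1)) => l; have := key l; rewrite min_r// ltW.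
Qed.

Lemma circle_dist_ge0 a b : 0 <= circle_dist a b.
Proof. by have [n ->] := circle_dist_attained a b. Qed.

Lemma circle_distxx a : circle_dist a a = 0.
Proof.
apply/eqP; rewrite eq_le circle_dist_ge0 andbT.
by rewrite (le_trans (circle_dist_le a a 0))// subrr mul0r addr0 normr0.
Qed.

Lemma circle_dist_sym a b : circle_dist a b = circle_dist b a.
Proof.
suff le c d : circle_dist c d <= circle_dist d c by apply/le_anti; rewrite !le.
have [n ->] := circle_dist_attained d c.
rewrite (le_trans (circle_dist_le c d (- n)))// -normrN.
by rewrite mulrNz mulNr opprD opprB opprK.
Qed.

Lemma circle_dist_triangle b a c :
  circle_dist a c <= circle_dist a b + circle_dist b c.
Proof.
have [n ->] := circle_dist_attained a b; have [l ->] := circle_dist_attained b c.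
rewrite (le_trans (circle_dist_le a c (n + l)))//.
rewrite (le_trans _ (ler_normD _ _))// le_eqVlt; apply/orP; left; apply/eqP.
by congr `| _ |; rewrite mulrzDr; ring.
Qed.

Lemma circle_dist_eq0 a b :
  circle_dist a b = 0 <-> exists n : int, a - b = n%:~R * th.
Proof.
split=> [|[n abn]].
  have [n ->] := circle_dist_attained a b => /normr0_eq0/eqP.
  by rewrite addr_eq0 => /eqP ->; exists (- n); rewrite mulrNz mulNr.
apply/eqP; rewrite eq_le circle_dist_ge0 andbT.
by rewrite (le_trans (circle_dist_le a b (- n)))// abn mulrNz mulNr subrr normr0.
Qed.

End CircleDistance.

Section Cone.
Context {R : realType} (theta : {posnum R}).
Local Notation th := (theta%:num).

Definition polar : Type := ({nonneg R} * R)%type.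
HB.instance Definition _ := Choice.copy polar ({nonneg R} * R)%type.

Implicit Types p q : polar.

(* One relation for both identifications of [0, oo) x R: the second coordinate
   modulo theta Z, and {0} x R to a point. *)
Definition cone_eq : rel polar := fun p q =>
  `[< p.1 = q.1 /\
      (p.1%:num = 0 \/ exists n : int, p.2 - q.2 = n%:~R * th) >].

Lemma cone_eqP p q : reflect
  (p.1 = q.1 /\ (p.1%:num = 0 \/ circle_dist theta p.2 q.2 = 0)) (cone_eq p q).
Proof.
apply: (iffP (asboolP _)) => -[pq h]; split=> //; case: h; [by left| |by left|].
  by move=> /circle_dist_eq0; right.
by move=> /circle_dist_eq0; right.
Qed.

Lemma cone_eq_refl : reflexive cone_eq.
Proof. by move=> p; apply/cone_eqP; split=> //; right; exact: circle_distxx. Qed.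

Lemma cone_eq_sym : symmetric cone_eq.
Proof.
suff h p q : cone_eq p q -> cone_eq q p by move=> p q; apply/idP/idP => /h.
by move=> /cone_eqP[pq h]; apply/cone_eqP; rewrite -pq circle_dist_sym.
Qed.

Lemma cone_eq_trans : transitive cone_eq.
Proof.
move=> q p r /cone_eqP[pq h1] /cone_eqP[qr h2]; apply/cone_eqP.
rewrite -qr -pq; split=> //; move: h2; rewrite -pq.
case: h1 => [->|h1]; first by left.
case=> [->|h2]; [by left|right].
apply/eqP; rewrite eq_le circle_dist_ge0 andbT.
by rewrite (le_trans (circle_dist_triangle theta q.2 _ _))// h1 h2 addr0.
Qed.

Canonical cone_equiv_rel :=
  EquivRel cone_eq cone_eq_refl cone_eq_sym cone_eq_trans.

Definition polar_dist p q : R :=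
  law_of_cosines p.1%:num q.1%:num (Num.min (circle_dist theta p.2 q.2) pi).

End Cone.

Definition cone (R : realType) (theta : {posnum R}) : Type :=
  {eq_quot cone_equiv_rel theta}.

HB.instance Definition _ (R : realType) (theta : {posnum R}) :=
  EqQuotient.on (cone theta).
HB.instance Definition _ (R : realType) (theta : {posnum R}) :=
  Choice.on (cone theta).

Section ConeMetric.
Context {R : realType} (theta : {posnum R}).
Implicit Types (p q r : polar (R := R)) (x y z : cone theta).
Local Notation angle p q := (Num.min (circle_dist theta p.2 q.2) pi).

Let angle_ge0 p q : 0 <= angle p q.
Proof. by rewrite le_min circle_dist_ge0 pi_ge0. Qed.

Let angle_lepi p q : angle p q <= pi.
Proof. by rewrite ge_min lexx orbT. Qed.

Lemma polar_distxx p : polar_dist theta p p = 0.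
Proof.
by rewrite /polar_dist circle_distxx min_l ?pi_ge0// law_of_cosinesxx.
Qed.

Lemma polar_dist_sym p q : polar_dist theta p q = polar_dist theta q p.
Proof. by rewrite /polar_dist law_of_cosines_sym circle_dist_sym. Qed.

Lemma polar_dist_triangle q p r :
  polar_dist theta p r <= polar_dist theta p q + polar_dist theta q r.
Proof.
rewrite /polar_dist.
have [le_pi|gt_pi] := lerP (angle p q + angle q r) pi.
  apply: le_trans (law_of_cosines_triangle _ _ _ _ _).
  apply: ler_law_of_cosines => //.
  have [h1|h1] := lerP (circle_dist theta p.2 q.2) pi; last first.
    by rewrite (le_trans (angle_lepi _ _))// lerDl.
  have [h2|h2] := lerP (circle_dist theta q.2 r.2) pi; last first.
    by rewrite (le_trans (angle_lepi _ _))// lerDr circle_dist_ge0.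
  by rewrite ge_min circle_dist_triangle.
have le1 : pi - angle p q <= angle q r by rewrite lerBlDl ltW.
have le2 : 0 <= pi - angle p q by rewrite subr_ge0.
apply: (@le_trans _ _ (law_of_cosines p.1%:num r.1%:num pi)).
  exact: ler_law_of_cosines.
rewrite -[pi in X in X <= _](subrKC (angle p q)).
apply: (le_trans (law_of_cosines_triangle _ q.1%:num _ _ _)).
by rewrite lerD2l ler_law_of_cosines.
Qed.

Lemma polar_dist_eq0 p q : polar_dist theta p q = 0 <-> cone_eq theta p q.
Proof.
split=> [/law_of_cosines_eq0 []// rs h|/cone_eqP[rs h]].
  apply/cone_eqP; split; first exact/val_inj.
  case: h => [|h]; [by left|right].
  move: h; case: lerP => // _ h.
  by have := pi_gt0 R; rewrite h ltxx.
rewrite /polar_dist -rs; case: h => [->|->].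
  by rewrite /law_of_cosines expr0n/= !mulr0 mul0r oppr0 !addr0 sqrtr0.
by rewrite min_l ?pi_ge0// law_of_cosinesxx.
Qed.

Definition cone_dist x y : R := polar_dist theta (repr x) (repr y).

Lemma cone_dist_pi p q :
  cone_dist (\pi_(cone theta) p) (\pi_(cone theta) q) = polar_dist theta p q.
Proof.
have rK u : polar_dist theta (repr (\pi_(cone theta) u)) u = 0.
  by apply/polar_dist_eq0/(@eqmodP _ (cone_equiv_rel theta)); rewrite reprK.
apply/le_anti/andP; split; rewrite /cone_dist.
  apply: le_trans (polar_dist_triangle p _ _) _; rewrite rK add0r.
  apply: le_trans (polar_dist_triangle q _ _) _.
  by rewrite [X in _ + X]polar_dist_sym rK addr0.
apply: le_trans (polar_dist_triangle (repr (\pi_(cone theta) p)) _ _) _.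
rewrite polar_dist_sym rK add0r.
apply: le_trans (polar_dist_triangle (repr (\pi_(cone theta) q)) _ _) _.
by rewrite rK addr0.
Qed.

Lemma cone_distxx x : cone_dist x x = 0.
Proof. exact: polar_distxx. Qed.

Lemma cone_dist_positivity x y : cone_dist x y = 0 -> x = y.
Proof.
move=> /polar_dist_eq0 h; rewrite -[x]reprK -[y]reprK.
exact/(@eqmodP _ (cone_equiv_rel theta)).
Qed.

Lemma cone_dist_sym x y : cone_dist x y = cone_dist y x.
Proof. exact: polar_dist_sym. Qed.

Lemma cone_dist_triangle y x z :
  cone_dist x z <= cone_dist x y + cone_dist y z.
Proof. exact: polar_dist_triangle. Qed.

HB.instance Definition _ := isMetric.Build R (cone theta)
  cone_distxx cone_dist_positivity cone_dist_sym cone_dist_triangle.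

End ConeMetric.

(* Main.v *)
(* The cone is the quotient of the plane by a finite group of rotations, and
   the projection does not increase distances.  A tree on a finite subset N of
   the cone is simply connected, so it lifts to the plane edge by edge with all
   edge lengths preserved; for every M in N the chosen lift of M has a minimal
   spanning tree at least as long as that of M, and the ratio of M is bounded
   below by that of its lift.  Conversely, far from the vertex the cone contains
   isometric copies of all bounded subsets of the plane.  Both inequalities thus
   come from one comparison: if every finite tree of Y can be mapped to X
   without decreasing distances and preserving the lengths of edges, then
   sr X <= sr Y. *)
Require Import Defs.
From mathcomp Require Import all_boot all_order all_algebra finmap.
From mathcomp Require Import generic_quotient.
From mathcomp Require Import all_classical all_reals all_analysis.
From mathcomp Require Import ring lra.

Set Implicit Arguments.
Unset Strict Implicit.
Unset Printing Implicit Defensive.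

Import Order.TTheory GRing.Theory Num.Theory.

Local Open Scope ring_scope.

(** * Finite trees: transport along bijections, stars, lifting along edges *)

Lemma connect_relpre (T T' : finType) (h : T' -> T) (e : rel T) x y :
  bijective h -> connect (relpre h e) x y = connect e (h x) (h y).
Proof.
move=> [g hK gK]; apply/connectP/connectP => -[p].
  move=> ep ->; exists (map h p); first by rewrite path_map.
  by rewrite last_map.
move=> ep /esym E; exists (map g p).
  by rewrite -path_map (mapK gK).
by apply: (bij_inj (f := h)); [exists g|rewrite -last_map (mapK gK) E].
Qed.

Lemma is_tree_relpre (T T' : finType) (h : T' -> T) (e : rel T) :
  bijective h -> is_tree e -> is_tree (relpre h e).
Proof.
move=> hb [es ei ec ey]; split.
- by move=> x y /=; rewrite es.
- by move=> x /=; rewrite ei.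
- by move=> x y; rewrite connect_relpre.
move=> c /andP[cc cu]; rewrite -(size_map h); apply: ey.
by rewrite /ucycle map_inj_uniq ?cu ?andbT ?cycle_map//; exact: bij_inj.
Qed.

Definition star (T : eqType) (c : T) : rel T := fun x y => (x == c) (+) (y == c).

(** Provides a tree on every nonempty vertex set. Every edge contains the centre, so a cycle on
    three or more vertices would visit it twice. *)
Lemma star_is_tree (T : finType) (c : T) : is_tree (star c).
Proof.
have es : symmetric (star c) by move=> x y; exact: addbC.
have toc x : connect (star c) x c.
  have [->|xc] := eqVneq x c; first exact: connect0.
  by apply: connect1; rewrite /star eqxx (negbTE xc).
split=> //; first by move=> x; exact: addbb.
  move=> x y; apply: connect_trans (toc x) _.
  by rewrite (sym_connect_sym es).
move=> [|x [|y [|z s]]]//; rewrite /ucycle /= !inE !negb_or {1 2}/star.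
case/andP => /and3P[xy yz zs] /and3P[/and3P[nxy nxz _] /andP[nyz ys] _].
have [yc|yc] := eqVneq y c; last first.
  move: xy yz; rewrite (negbTE yc); case: eqP => // xc; case: eqP => // zc.
  by rewrite xc zc eqxx in nxz.
have xc : (x == c) = false by rewrite -yc (negbTE nxy).
have zc : (z == c) = false by rewrite -yc eq_sym (negbTE nyz).
case: s ys zs {nxz} => [_|w s ys] /=; first by rewrite /star xc zc.
case/andP; rewrite /star zc; case: eqP => // wc.
by rewrite wc -yc inE eqxx in ys.
Qed.

(* Every edge leads from the part already lifted to a vertex outside it, and
   such a vertex has a single neighbour in that part since a second one would
   close a cycle. *)
Lemma tree_lift (T : finType) (A : Type) (e : rel T)
    (P : T -> A -> Prop) (Q : A -> A -> Prop) :
  is_tree e -> (forall a b, Q a b -> Q b a) -> (forall u, exists a, P u a) ->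
  (forall u v a, P u a -> exists2 b, P v b & Q a b) ->
  exists s : T -> A,
    (forall u, P u (s u)) /\ (forall u v, e u v -> Q (s u) (s v)).
Proof.
move=> [es ei ec ey] Qs P0 PQ.
have [s0 s0P] := choice P0.
have [T0|T0] := posnP #|T|.
  by exists s0; split=> // u; have := card0_eq T0 u.
have /card_gt0P[x0 _] := T0.
pose eS (S : {set T}) := [rel x y | [&& e x y, x \in S & y \in S]].
(* The map [s] is total: outside [S] it satisfies [P], while [Q] is claimed only for edges inside
   [S]. *)
have step n : (n < #|T|)%N -> exists (S : {set T}) (s : T -> A),
   [/\ #|S| = n.+1, forall u, P u (s u),
     {in S &, forall u v, e u v -> Q (s u) (s v)},
     {in S &, forall u v, connect (eS S) u v} & x0 \in S].
  elim: n => [_|n IH nT].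
    exists [set x0], s0; split; rewrite ?cards1 ?inE//.
      by move=> u v /set1P -> /set1P ->; rewrite ei.
    by move=> u v /set1P -> /set1P ->; exact: connect0.
  have [S [s [Sn sP sQ Sc Sx]]] := IH (ltnW nT).
  have [v vS] : exists v, v \notin S.
    apply/existsP; rewrite -negb_forall; apply: contraTN nT => /forallP h.
    rewrite -leqNgt -Sn; apply/subset_leq_card/fintype.subsetP => x _.
    exact: h.
  have [u [w [uS wS uw]]] : exists u w, [/\ u \in S, w \notin S & e u w].
    have /connectP[p] := ec x0 v; elim: p (x0) Sx => [|y p IHp] x xS /=.
      by move=> _ E; rewrite E xS in vS.
    case/andP=> xy yp vE; have [yS|yS] := boolP (y \in S).
      exact: IHp yS yp vE.
    by exists x, y.
  have uniq_nb u' : u' \in S -> e u' w -> u' = u.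
    move=> u'S u'w; apply/eqP; apply: contraT => uu'.
    have /connectP[p ep lp] := Sc _ _ u'S uS.
    case/shortenP: ep lp => p' ep' up' _ lp.
    have pS : {subset p' <= S}.
      elim: (p') (u') ep' => [//|y q IHq] z /= /andP[/and3P[_ _ yS] h] t.
      by rewrite inE => /predU1P[->//|]; apply: IHq h t.
    have ep2 : path e u' p' by apply: sub_path ep' => ? ? /and3P[].
    (* This cycle runs from [w] to [u'], inside [S] to [u], and back to [w]; since [u'] differs from
       [u], [p'] is nonempty and the cycle has at least three vertices. *)
    have := ey (w :: u' :: p').
    rewrite /ucycle (cons_uniq w) up' inE negb_or andbT.
    have -> : w != u' by apply: contraNneq wS => ->.
    have -> : w \notin p' by apply: contra wS => /pS.
    rewrite /= rcons_path ep2 -lp uw es u'w => /(_ isT).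
    by case: p' lp {up' ep' pS ep2} => //= lp; rewrite lp eqxx in uu'.
  have [b Pb Qb] := PQ u w (s u) (sP u).
  exists (w |: S), (fun x => if x == w then b else s x); split.
  - by rewrite cardsU1 wS Sn.
  - by move=> x; case: eqP => [->|].
  - move=> x y /setU1P[->|xS] /setU1P[->|yS]; rewrite ?eqxx ?ei//.
    + move=> wy; have yu : y = u by apply: uniq_nb => //; rewrite es.
      rewrite yu ifN; first exact: Qs.
      by apply: contraNneq wS => <-.
    + move=> xw; have -> : x = u by exact: uniq_nb.
      by rewrite ifN //; apply: contraNneq wS => <-.
    + rewrite !ifN; first exact: sQ.
        by apply: contraNneq wS => <-.
      by apply: contraNneq wS => <-.
  - have sub x y : connect (eS S) x y -> connect (eS (w |: S)) x y.
      apply: connect_sub => a b' /and3P[ab aS bS]; apply: connect1.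
      by rewrite /= ab !inE aS bS !orbT.
    have csym : connect_sym (eS (w |: S)).
      by apply: sym_connect_sym => a b' /=; rewrite es [(a \in _) && _]andbC.
    have cu x : x \in w |: S -> connect (eS (w |: S)) u x.
      move=> /setU1P[->|xS]; last by apply: sub; apply: Sc.
      by apply: connect1; rewrite /= uw !inE uS eqxx orbT.
    move=> x y xS yS; apply: connect_trans (cu y yS).
    by rewrite csym; exact: cu.
  - by rewrite inE Sx orbT.
have [|S [s [Sn sP sQ _ _]]] := step #|T|.-1; first by rewrite prednK.
exists s; split=> // u v; apply: sQ.
all: rewrite (_ : S = [set: T]%SET) ?inE//; apply/eqP.
all: by rewrite eqEcard finset.subsetT /= cardsT Sn prednK.
Qed.

(** * Lengths of labelled trees and the comparison of Steiner ratios *)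

Lemma fset_image_bij (K : choiceType) (T : finType) (f : T -> K) :
  injective f ->
  exists2 h : T -> [fset f x | x in T]%fset,
    bijective h & forall x, val (h x) = f x.
Proof.
move=> fi; have fM x : f x \in [fset f x | x in T]%fset.
  by apply/imfsetP; exists x.
exists (fun x => [` fM x]%fset) => //.
apply: inj_card_bij => [x y /(congr1 val)/fi//|].
by rewrite -cardfE card_imfset //= -cardE.
Qed.

Section TreeLength.
Context {R : realType} (X : metricType R).
Implicit Types M N : {fset X}.

(* tree_length for a graph whose vertices are labelled by points of X; as
   there, every edge is counted twice by the sum. *)
Definition graph_length (T : finType) (f : T -> X) (e : rel T) : R :=
  (\sum_(x : T) \sum_(y : T | e x y) mdist (f x) (f y)) / 2.

Lemma graph_length_relpre (T T' : finType) (h : T' -> T) (f : T -> X) (e : rel T) :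
  bijective h -> graph_length (f \o h) (relpre h e) = graph_length f e.
Proof.
move=> hb; congr (_ / 2); rewrite [RHS](reindex h) /=; last exact: onW_bij.
by apply: eq_bigr => x _; rewrite [RHS](reindex h) //; exact: onW_bij.
Qed.

Lemma graph_length_ge0 (T : finType) (f : T -> X) (e : rel T) :
  0 <= graph_length f e.
Proof.
rewrite divr_ge0 // !sumr_ge0 // => x _.
by rewrite sumr_ge0 // => y _; exact: mdist_ge0.
Qed.

Lemma mst_ge0 M : 0 <= mst M.
Proof.
rewrite /mst; set E := (X in inf X).
have [->|/set0P E0] := eqVneq E set0; first by rewrite inf0.
by apply: lb_le_inf => // _ [e _ ->]; exact: graph_length_ge0.
Qed.

Lemma mst_le M (e : rel M) : is_tree e -> mst M <= tree_length e.
Proof.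
move=> et; apply: ge_inf; last by exists e.
by exists 0 => _ [e' _ ->]; exact: graph_length_ge0.
Qed.

(** The star centred at [x] shows that the infimum is over a nonempty set. *)
Lemma le_mst M (x : X) (c : R) : x \in M ->
  (forall e : rel M, is_tree e -> c <= tree_length e) -> c <= mst M.
Proof.
move=> xM h; apply: lb_le_inf; last by move=> _ [e et ->]; exact: h.
exists (tree_length (star [` xM]%fset)), (star [` xM]%fset) => //.
exact: star_is_tree.
Qed.

Lemma smt_ge0 M : 0 <= smt M.
Proof.
apply: lb_le_inf; first by exists (mst M), M => //=; exact: fsubset_refl.
by move=> _ [N _ <-]; exact: mst_ge0.
Qed.

Lemma smt_le M N : (M `<=` N)%fset -> smt M <= mst N.
Proof.
move=> MN; apply: ge_inf; last by exists N.
by exists 0 => _ [N' _ <-]; exact: mst_ge0.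
Qed.

(** A lower bound uniform in the tree: [x0] has a neighbour in every tree, at least as far away as
    the point [y] of [M] nearest to [x0]. *)
Lemma mst_gt0 M : (2 <= #|` M|)%N -> 0 < mst M.
Proof.
rewrite cardfE => /card_gt1P[x0 [x1 [_ _ x01]]].
pose d (y : M) := mdist (val x0) (val y).
have x10 : x1 != x0 by rewrite eq_sym.
have [y yx0 ymin] := @arg_minP _ _ _ x1 (fun y => y != x0) d x10.
have dy0 : 0 < d y.
  by rewrite mdist_gt0; apply: contraNneq yx0 => /val_inj ->.
(* Only one of the two ordered pairs of the edge at [x0] is kept, hence the half. *)
apply: (@lt_le_trans _ _ (d y / 2)); first by rewrite divr_gt0.
apply: (le_mst (valP x0)) => e [es ei ec _].
have [z xz] : exists z, e x0 z.
  have /connectP[[|z p] /=] := ec x0 x1; first by move=> _ E; rewrite E eqxx in x10.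
  by case/andP; exists z.
have zx0 : z != x0 by apply: contraTneq xz => ->; rewrite ei.
rewrite ler_pM2r ?invr_gt0 // (le_trans (ymin z zx0)) //.
have dge0 u v : 0 <= mdist (val u) (val v) :> R by exact: mdist_ge0.
rewrite (bigD1 x0) //= (bigD1 z) //= -addrA lerDl addr_ge0 // ?sumr_ge0 // => u _.
by rewrite sumr_ge0.
Qed.

Lemma mst_image_le (T : finType) (f : T -> X) (e : rel T) :
  injective f -> is_tree e -> mst [fset f x | x in T]%fset <= graph_length f e.
Proof.
move=> fi et; have [h [g hK gK] hf] := fset_image_bij fi.
have gb : bijective g by exists h.
rewrite -(graph_length_relpre f e gb).
rewrite (_ : f \o g = val); first exact/mst_le/is_tree_relpre.
by apply/funext => x; rewrite /= -hf gK.
Qed.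

Lemma le_mst_image (T : finType) (f : T -> X) (x : T) (c : R) : injective f ->
  (forall e : rel T, is_tree e -> c <= graph_length f e) ->
  c <= mst [fset f x | x in T]%fset.
Proof.
move=> fi h; have [g gb gf] := fset_image_bij fi.
have fx : f x \in [fset f x | x in T]%fset by apply/imfsetP; exists x.
apply: (le_mst fx) => e et.
rewrite -[leRHS](graph_length_relpre val e gb) (_ : val \o g = f); last exact/funext.
exact/h/is_tree_relpre.
Qed.

Lemma steiner_ratio_le M : (2 <= #|` M|)%N -> steiner_ratio X <= smt M / mst M.
Proof.
move=> M2; apply: ge_inf; last by exists M.
by exists 0 => _ [N _ <-]; rewrite divr_ge0 // ?smt_ge0 ?mst_ge0.
Qed.

End TreeLength.

(** For each tree [e] on some [N] containing [M], the image [M'] of [M] depends on [e]. The image of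
    [e] gives [smt M' <= tree_length e] and expansion gives [mst M <= mst M'], so the ratio of [M']
    is at most [tree_length e / mst M]. The points [y0], [y1] keep the infimum for [Y] from being
    that of the empty set. *)
Lemma steiner_ratio_le_lift (R : realType) (X Y : metricType R) (y0 y1 : Y) :
  y0 != y1 ->
  (forall (N : {fset Y}) (e : rel N), is_tree e -> exists s : N -> X,
     (forall u v, mdist (val u) (val v) <= mdist (s u) (s v)) /\
     (forall u v, e u v -> mdist (s u) (s v) = mdist (val u) (val v))) ->
  steiner_ratio X <= steiner_ratio Y.
Proof.
move=> y01 lift; apply: lb_le_inf.
  exists (steiner_ratio_of [fset y0; y1]%fset), [fset y0; y1]%fset => //=.
  by rewrite cardfs2 y01.
move=> _ [M /= M2 <-].
have m0 := mst_gt0 M2.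
rewrite ler_pdivlMr //; apply: lb_le_inf.
  by exists (mst M), M => //=; exact: fsubset_refl.
move=> _ [N /= MN <-].
have [x xM] : exists x, x \in M.
  by apply/fset0Pn; rewrite -cardfs_gt0 ltnW.
apply: (@le_mst _ _ _ x); first exact: (fsubsetP MN).
move=> e et; have [s [sle seq]] := lift N e et.
have si : injective s.
  move=> u v suv; apply/val_inj/mdist_positivity/le_anti.
  by rewrite mdist_ge0 andbT (le_trans (sle _ _)) // suv mdistxx.
pose i : M -> N := fincl MN.
have ii : injective i by exact: fincl_inj.
have sii : injective (s \o i) by exact: inj_comp.
set M' := [fset (s \o i) x | x in {: M}]%fset.
have M'2 : (2 <= #|` M'|)%N by rewrite card_imfset //= -cardE -cardfE.
have sM' : smt M' <= tree_length e.
  have M'N : (M' `<=` [fset s x | x in {: N}])%fset.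
    by apply/fsubsetP => _ /imfsetP[u _ ->]; apply/imfsetP; exists (i u).
  apply: le_trans (smt_le M'N) _; apply: le_trans (mst_image_le si et) _.
  rewrite le_eqVlt; apply/orP; left; apply/eqP; congr (_ / 2).
  by apply: eq_bigr => u _; apply: eq_bigr => v; exact: seq.
have mM' : mst M <= mst M'.
  apply: (le_mst_image [` xM]%fset) => // e' et'.
  apply: le_trans (mst_le et') _; rewrite ler_pM2r ?invr_gt0 //.
  by apply: ler_sum => u _; apply: ler_sum => v _; exact: (sle (i u) (i v)).
rewrite -(ler_pdivlMr _ _ m0); apply: le_trans (steiner_ratio_le M'2) _.
by rewrite ler_pM ?smt_ge0 ?invr_ge0 ?mst_ge0 // lef_pV2 // posrE (lt_le_trans m0).
Qed.

(** * Angles on the circle and the two inequalities between cone and plane *)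

Section Circle.
Context {R : realType}.
Implicit Types (theta : {posnum R}) (a b r s : R).

(** An optimal shift [n] is no worse than [n - 1] and [n + 1]. *)
Lemma circle_dist_le_half theta a b : circle_dist theta a b <= theta%:num / 2.
Proof.
have [n nE] := circle_dist_attained theta a b.
have := circle_dist_le theta a b (n + 1).
have := circle_dist_le theta a b (n - 1).
have : 0 < theta%:num by [].
rewrite nE !intrD mulrNz mulrBl mulrDl mul1r !addrA.
set x := a - b + _; set t := theta%:num => t0.
case: (ger0P x) => x0; case: (ger0P (x - t)) => xt1;
  case: (ger0P (x + t)) => xt2; lra.
Qed.

(** A nonzero shift moves [a - b] by at least [theta], so its absolute value ends up at least
    [theta / 2]. *)
Lemma circle_distE theta a b :
  `|a - b| <= theta%:num / 2 -> circle_dist theta a b = `|a - b|.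
Proof.
move=> ab; apply/le_anti/andP; split.
  by have := circle_dist_le theta a b 0; rewrite mul0r addr0.
have [n ->] := circle_dist_attained theta a b.
have [->|n0] := eqVneq n 0; first by rewrite mul0r addr0.
have t0 : 0 < theta%:num by [].
have n1 : 1 <= `|n%:~R : R|.
  by rewrite -intr_norm ler1z -gtz0_ge1 normr_gt0.
have h : theta%:num <= `|n%:~R * theta%:num|.
  by rewrite normrM (gtr0_norm t0) ler_peMl // ltW.
have := ler_normB (a - b + n%:~R * theta%:num) (a - b).
rewrite addrAC subrr add0r; lra.
Qed.

Lemma cosDz2pi a (n : int) : cos (a + n%:~R * (2 * pi)) = cos a.
Proof.
have cosDn (m : nat) (x : R) : cos (x + m%:R * (2 * pi)) = cos x.
  by rewrite !mulr_natl periodicn //; exact: cosD2pi.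
case: n => n; first exact: cosDn.
by rewrite NegzE mulrNz mulNr -(cosDn n.+1 (_ - _)) subrK.
Qed.

Lemma law_of_cosines_norm r s a : law_of_cosines r s `|a| = law_of_cosines r s a.
Proof. by rewrite /law_of_cosines; case: (ger0P a) => // _; rewrite cosN. Qed.

Definition cartesian (p : polar (R := R)) : plane R :=
  (p.1%:num * cos p.2, p.1%:num * sin p.2).

Lemma plane_dist_cartesian (p q : polar (R := R)) :
  plane_dist (cartesian p) (cartesian q) =
  law_of_cosines p.1%:num q.1%:num (p.2 - q.2).
Proof. by rewrite law_of_cosinesE. Qed.

Lemma steiner_ratio_plane_le_cone (k : nat) theta :
  (0 < k)%N -> theta%:num = 2 * pi / k%:R ->
  steiner_ratio (plane R) <= steiner_ratio (cone theta).
Proof.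
move=> k0 thE.
have kn0 : k%:R != 0 :> R by rewrite pnatr_eq0 -lt0n.
have pi0 : 0 < pi :> R := pi_gt0 R.
have th2 : theta%:num / 2 <= pi.
  rewrite (_ : _ / 2 = pi / k%:R); last by rewrite thE; field.
  by rewrite ler_pdivrMr ?ltr0n // ler_peMr ?ler1n // ltW.
have short a b : Num.min (circle_dist theta a b) pi = circle_dist theta a b.
  by rewrite min_l // (le_trans (circle_dist_le_half _ _ _)).
(* The angle in the plane is the circle distance for [tau], equal to 2 pi. As [k] times [theta] is
   [tau], a shift by [n] turns is a shift by [n * k] multiples of [theta], so the angle in the cone
   is no larger. *)
have contract p q :
    polar_dist theta p q <= plane_dist (cartesian p) (cartesian q).
  have tp : 0 < 2 * pi :> R by rewrite mulr_gt0.
  pose tau := PosNum tp.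
  have [n nE] := circle_dist_attained tau p.2 q.2.
  have -> : plane_dist (cartesian p) (cartesian q) =
      law_of_cosines p.1%:num q.1%:num (circle_dist tau p.2 q.2).
    by rewrite plane_dist_cartesian nE law_of_cosines_norm /law_of_cosines cosDz2pi.
  rewrite /polar_dist short ler_law_of_cosines ?circle_dist_ge0 //.
    rewrite nE (le_trans (circle_dist_le _ _ _ (n * k%:Z))) //.
    rewrite (_ : (n * k%:Z)%:~R * theta%:num = n%:~R * tau%:num) //.
    by rewrite thE intrM /=; field.
  by rewrite (le_trans (circle_dist_le_half _ _ _)) //= mulrC mulKf.
pose zero : {nonneg R} := NngNum (lexx (0 : R)).
pose one : {nonneg R} := NngNum (ler01 : 0 <= 1 :> R).
apply: (@steiner_ratio_le_lift _ _ _
  (\pi_(cone theta) (zero, 0))%qT (\pi_(cone theta) (one, 0))%qT).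
  apply/negP => /eqP/(@eqmodP _ (cone_equiv_rel theta))/cone_eqP[].
  by move=> /(congr1 (fun x : {nonneg R} => x%:num))/eqP; rewrite eq_sym oner_eq0.
move=> N e et.
have [s [sN sd]] : exists s : N -> polar (R := R),
    (forall u, (\pi_(cone theta) (s u))%qT = val u) /\
    (forall u v, e u v -> plane_dist (cartesian (s u)) (cartesian (s v)) =
                          polar_dist theta (s u) (s v)).
  apply: (tree_lift (P := fun (u : N) p => (\pi_(cone theta) p)%qT = val u)
    (Q := fun p q =>
       plane_dist (cartesian p) (cartesian q) = polar_dist theta p q) et).
  - by move=> p q; rewrite plane_dist_sym polar_dist_sym.
  - by move=> u; exists (repr (val u)); exact: reprK.
  move=> u v p pu; pose q := repr (val v).
  (* Turning [q] by the optimal multiple of [theta] keeps its class in the cone and makes its plane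
     angle to [p] equal to the cone angle. *)
  have [n nE] := circle_dist_attained theta p.2 q.2.
  have qq : cone_eq theta (q.1, q.2 - n%:~R * theta%:num) q.
    apply/asboolP; split=> //=; right; exists (- n).
    by rewrite mulrNz mulNr addrAC subrr add0r.
  have qv : (\pi_(cone theta) (q.1, q.2 - n%:~R * theta%:num))%qT = val v.
    by rewrite -[RHS]reprK; exact/(@eqmodP _ (cone_equiv_rel theta)).
  exists (q.1, q.2 - n%:~R * theta%:num) => //.
  rewrite -cone_dist_pi qv -[val v]reprK cone_dist_pi.
  rewrite plane_dist_cartesian /= /polar_dist short nE law_of_cosines_norm.
  by congr law_of_cosines; rewrite opprB addrCA addrC.
exists (cartesian \o s); split=> u v.
  rewrite -[val u]sN -[val v]sN; apply: le_trans (contract _ _).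
  by rewrite -cone_dist_pi.
by move=> /sd E; rewrite -[val u]sN -[val v]sN [RHS]cone_dist_pi.
Qed.

Lemma steiner_ratio_cone_le_plane theta :
  steiner_ratio (cone theta) <= steiner_ratio (plane R).
Proof.
have pi0 : 0 < pi :> R := pi_gt0 R.
have th0 : 0 < theta%:num by [].
apply: (@steiner_ratio_le_lift _ _ _ ((0, 0) : plane R) ((1, 0) : plane R)).
  by apply/negP => /eqP[/eqP]; rewrite eq_sym oner_eq0.
move=> N e _.
(* With a quarter here, two such angles differ by at most half of [theta] and of pi, so
   [circle_distE] applies and the cut-off at pi is not reached. *)
have [d d0 dP] : exists2 d : R, 0 < d &
    forall t, `|t| < d -> `|atan t| <= Num.min theta%:num pi / 4.
  have m0 : 0 < Num.min theta%:num pi / 4 by rewrite divr_gt0 // lt_min th0.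
  have /cvgrPdist_le /(_ _ m0) := @continuous_atan R 0.
  rewrite atan0 => /nbhs_ballP[d /= d0 dP]; exists d => // t td.
  by rewrite -[atan t]opprK normrN -[- _]add0r; apply: dP; rewrite /ball /= sub0r normrN.
(* After the translation by (D, 0), all points of N are seen from the vertex
   within a sector of angle at most theta / 2 and pi / 2. *)
pose B := \sum_(u : N) (`|(val u).1| + `|(val u).2|).
have Bx (u : N) : `|(val u).1| + `|(val u).2| <= B.
  by rewrite /B (bigD1 u) //= lerDl sumr_ge0 // => v _; rewrite addr_ge0.
(* The summand [B + 1] makes all abscissas positive, and [B / d] brings the slopes below [d]. *)
pose D := B + 1 + B / d.
have Dx (u : N) : 0 < D + (val u).1 /\ `|(val u).2 / (D + (val u).1)| < d.
  have := Bx u; set x := (val u).1; set y := (val u).2 => xy.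
  have x0 : 0 <= `|x| by [].
  have y0 : 0 <= `|y| by [].
  have x1 : - x <= `|x| by rewrite -normrN ler_norm.
  have B0 : 0 <= B by lra.
  have Bd : 0 <= B / d by rewrite divr_ge0 // ltW.
  have Dx0 : 0 < D + x by rewrite /D; lra.
  split=> //; rewrite normrM normfV (gtr0_norm Dx0) ltr_pdivrMr // mulrC.
  rewrite -ltr_pdivrMr //.
  have : `|y| / d <= B / d by rewrite ler_pM2r ?invr_gt0 //; lra.
  by rewrite /D; lra.
pose phi (u : N) := atan ((val u).2 / (D + (val u).1)).
have cphi u : 0 < cos (phi u) by rewrite cos_gt0_pihalf // atan_gtNpi2 atan_ltpi2.
have r0 u : 0 <= (D + (val u).1) / cos (phi u).
  by rewrite divr_ge0 // ltW //; case: (Dx u).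
pose s (u : N) : polar (R := R) := (NngNum (r0 u), phi u).
have sE u : cartesian (s u) = (D + (val u).1, (val u).2).
  rewrite /cartesian /=; congr pair; first by rewrite divfK // gt_eqF.
  rewrite mulrAC -mulrA -/(tan (phi u)) /phi atanK mulrC divfK //.
  by rewrite gt_eqF //; case: (Dx u).
have isom u v : polar_dist theta (s u) (s v) = mdist (val u) (val v).
  transitivity (plane_dist (cartesian (s u)) (cartesian (s v))); last first.
    by rewrite !sE /plane_dist /= opprD addrACA subrr add0r.
  have h w : `|phi w| <= theta%:num / 4 /\ `|phi w| <= pi / 4.
    have [_ /dP] := Dx w; rewrite -/(phi w) ler_pdivlMr // le_min => /andP[h1 h2].
    by rewrite !ler_pdivlMr.
  have [hu1 hu2] := h u; have [hv1 hv2] := h v.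
  have := ler_normB (phi u) (phi v) => huv.
  rewrite plane_dist_cartesian /polar_dist circle_distE /=; last lra.
  by rewrite min_l ?law_of_cosines_norm //; lra.
exists (fun u => (\pi_(cone theta) (s u))%qT); split=> u v.
  by rewrite -isom -cone_dist_pi.
by move=> _; rewrite -isom -cone_dist_pi.
Qed.

End Circle.

Theorem corollary4p5 (R : realType) (k : nat) (theta : {posnum R}) :
  (0 < k)%N -> theta%:num = 2 * pi / k%:R ->
  steiner_ratio (cone theta) = steiner_ratio (plane R).
Proof.
move=> k0 thE; apply/le_anti; rewrite steiner_ratio_cone_le_plane.
exact: steiner_ratio_plane_le_cone thE.
Qed.
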